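(* Fix an integer $q\ge 2$. There exist constants $c_1,c_2>0$ and $N$ (depending only on $q$) such that for all integers $n\ge N$ and all positive integers $r$ and $m$ with $m\ge c_1 n/\log n$, there exists an $\mathrm{RMDS}_q$ matrix $M\in\mathbb{Z}^{rm\times n}$ with all entries in $\{-W,\dots,W\}$, where $W=\lceil c_2 r\rceil$. (That is, $\mathrm{RMDS}_q$ matrices with entries bounded by $W=O(r)$ exist when $m=\Omega(n/\log n)$.)
   Context: For an integer $q\ge 2$, a matrix $B\in\mathbb{Z}^{m\times n}$ is an $\mathrm{EQ}_q$ matrix if $Bx=0$ has no non-trivial solution $x\in\{-q+1,\dots,q-1\}^n$. A matrix $M\in\mathbb{Z}^{rm\times n}$ is called $\mathrm{RMDS}_q$ with MDS rate $r$ and EQ rate $n/m$ if every $m\times n$ submatrix of $M$ (formed by choosing any $m$ of its $rm$ rows) is an $\mathrm{EQ}_q$ matrix. *)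

(* Defs.v *)
From mathcomp Require Import all_boot all_order all_algebra.
From mathcomp Require Import reals exp.
Set Implicit Arguments.
Unset Strict Implicit.
Unset Printing Implicit Defensive.
Import Order.TTheory GRing.Theory Num.Theory.
Local Open Scope ring_scope.

Definition EQ_matrix (q m n : nat) (B : 'M[int]_(m, n)) : Prop :=
  forall x : 'cV[int]_n,
    (forall i : 'I_n, - q%:Z + 1 <= x i ord0 <= q%:Z - 1) ->
    B *m x = 0 -> x = 0.

(* An m-row submatrix is [rowsub f M], where the strictly increasing map [f]
   enumerates the chosen rows in their original order. *)
Definition RMDS_matrix (q r m n : nat) (M : 'M[int]_(r * m, n)) : Prop :=
  forall f : 'I_m -> 'I_(r * m),
    (forall i j : 'I_m, (i < j)%N -> (f i < f j)%N) ->
    EQ_matrix q (rowsub f M).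

(* Main.v *)
Require Import Defs.
From mathcomp Require Import all_boot all_order all_algebra.
From mathcomp Require Import reals sequences exp ring lra zify.
Set Implicit Arguments.
Unset Strict Implicit.
Unset Printing Implicit Defensive.
Import Order.TTheory GRing.Theory Num.Theory.

(* The matrix exists by the probabilistic method: take independent entries,
   uniform on [{-L, ..., L - 1}] with [L = K * r].  It is RMDS iff every nonzero
   [x] in the box is orthogonal to fewer than [m] rows.  If [s] coordinates of
   [x] are nonzero, then one nonzero value occurs at [k >= s / (2q + 1)] places,
   and writing an entry as [b + L * eps - L] with [b < L] and [eps] a bit shows
   that a row is orthogonal to [x] with probability
   [p <= 'C(k, k/2) / (2 ^ k * L) <= 1 / (L * sqrt k)].  By Markov's inequality
   [m] of the [r * m] rows are orthogonal to [x] with probability at most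
   [(e * r * p) ^ m = (e / (K * sqrt k)) ^ m].  In the union bound the [x] with
   [s <= sqrt n] number at most [exp (O(sqrt n * ln n))] and contribute
   [exp (- m)] each; the others number at most [(2q + 1) ^ n] and contribute
   [exp (- m) * n ^ (- m / 4)] each, which is beaten as soon as
   [m * ln n >= c1 * n]. *)

(** * Binomial coefficients near the middle *)

Lemma bin_le_central j e : 'C(j.*2, e) <= 'C(j.*2, j).
Proof.
have low d : d <= j -> 'C(j.*2, j - d) <= 'C(j.*2, j).
  elim: d => [|d IHd] ltdj; first by rewrite subn0.
  apply: leq_trans (IHd (ltnW ltdj)).
  have := mul_bin_left j.*2 (j - d.+1).
  rewrite -(subnSK ltdj) => E.
  have lt : (j - d.+1).+1 <= j.*2 - (j - d.+1) by lia.
  by rewrite -(leq_pmul2l (ltn0Sn (j - d.+1))) E leq_mul2r lt orbT.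
have [lej|ltj] := leqP e j; first by rewrite -(subKn lej) low ?leq_subr.
have [le2|lt2] := leqP e j.*2; last by rewrite bin_small.
rewrite -bin_sub // (_ : j.*2 - e = j - (e - j)); last by lia.
by apply: low; lia.
Qed.

(** Going from [j] to [j.+1] multiplies the left side by [4 (2j+1) (2j+3) / (j+1)^2], which is at
    most 16 because [(2j+1) (2j+3) <= (2j+2)^2]. *)
Lemma central_bin_sqr j : 'C(j.*2, j) ^ 2 * j.*2.+1 <= 16 ^ j.
Proof.
elim: j => [|j IHj] //.
have E : 'C(j.*2.+2, j.+1) * j.+1 = 'C(j.*2, j) * (2 * j.*2.+1).
  have := mul_bin_diag j.*2.+2 j; have := mul_bin_diag j.*2.+1 j.
  have -> : 'C(j.*2.+1, j.+1) = 'C(j.*2.+1, j).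
    by rewrite -bin_sub //; [congr 'C(_, _)|]; lia.
  have := mul_bin_left j.*2.+1 j; have := mul_bin_left j.*2 j.
  have := binS j.*2 j; rewrite /=; nia.
rewrite doubleS (expnS 16) -(@leq_pmul2l (j.+1 ^ 2)) ?expn_gt0 //.
have -> : j.+1 ^ 2 * ('C(j.*2.+2, j.+1) ^ 2 * j.*2.+3) =
          'C(j.*2, j) ^ 2 * j.*2.+1 * (4 * j.*2.+1 * j.*2.+3).
  by rewrite mulnA -expnMn (mulnC j.+1) E; ring.
have -> : j.+1 ^ 2 * (16 * 16 ^ j) = 16 ^ j * (16 * j.+1 ^ 2) by ring.
by apply: leq_mul => //; nia.
Qed.

(** This is ['C(k, e) <= 2^k / sqrt k] without the root. For [k = 2j+1], Pascal's rule gives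
    ['C(k, e) <= 2 'C(2j, j)], and squaring the 2 yields the extra factor 4. *)
Lemma bin_sqr_mul k e : 'C(k, e) ^ 2 * k <= 4 ^ k.
Proof.
rewrite -(odd_double_half k); set j := k./2.
have E4 : 4 ^ j.*2 = 16 ^ j by rewrite -mul2n expnM.
have cent := central_bin_sqr j.
case: (odd k); rewrite ?add1n ?add0n ?(expnS 4) E4; last first.
  by apply: leq_trans cent; rewrite leq_mul // leq_exp2r // bin_le_central.
have bnd : 'C(j.*2.+1, e) <= 2 * 'C(j.*2, j).
  case: e => [|e]; first by rewrite bin0 muln_gt0 bin_gt0; lia.
  by rewrite binS mul2n -[leqRHS]addnn leq_add ?bin_le_central.
apply: (@leq_trans ((2 * 'C(j.*2, j)) ^ 2 * j.*2.+1)).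
  by rewrite leq_mul2r leq_exp2r // bnd orbT.
by rewrite expnMn -mulnA leq_mul2l.
Qed.

Local Open Scope ring_scope.

(** * Counting the rows orthogonal to a fixed vector *)

Lemma leq_card_fibers (X U : finType) (A : {set X}) (Y : {set U})
    (g : X -> U) (c : nat) :
    (forall a, a \in A -> g a \in Y) ->
    (forall a, a \in A -> #|[set a' in A | g a' == g a]| <= c)%N ->
  (#|A| <= c * #|Y|)%N.
Proof.
move=> gY fib; rewrite -sum1_card (partition_big g (mem Y)) //=.
rewrite mulnC -sum_nat_const; apply: leq_sum => y _.
have [a /andP[aA /eqP <-]|no] := pickP [pred a | (a \in A) && (g a == y)].
  apply: leq_trans (fib a aA); rewrite -sum1_card.
  by under [leqRHS]eq_bigl do rewrite inE.
by rewrite big_pred0.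
Qed.

(* For a uniformly random [a] the entries are independent and uniform on
   [{-l, ..., l - 1}]; splitting off the factor [l] is what makes the sums below
   amenable to Euclidean division. *)
Definition entry n l (a : {set 'I_n} * {ffun 'I_n -> 'I_l}) (j : 'I_n) : int :=
  (a.2 j)%:Z + (l * (j \in a.1))%:Z - l%:Z.

Lemma entry_bounds n l (a : {set 'I_n} * {ffun 'I_n -> 'I_l}) j :
  - l%:Z <= entry a j <= l%:Z.
Proof. by rewrite /entry; have := ltn_ord (a.2 j); case: (j \in _); lia. Qed.

Lemma eq_digits l b e b' e' : (b < l)%N -> (b' < l)%N ->
  (b + l * e = b' + l * e')%N -> b = b' /\ e = e'.
Proof.
move=> ltb ltb' E.
have := edivn_eq e ltb; have := edivn_eq e' ltb'.
by rewrite ![(_ * l + _)%N]addnC ![(_ * l)%N]mulnC E => -> [-> ->].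
Qed.

(* Fix the entries of [a] off [T], and all low digits [a.2 j] except the one at
   a point [j0] of [T].  Orthogonality to [x] then determines
   [a.2 j0 + l * #|a.1 :&: T|], hence [a.2 j0] and [#|a.1 :&: T|]. *)
Lemma card_orthogonal_sqr n l (x : 'I_n -> int) (v : int)
    (T := [set j | x j == v]) : v != 0 -> (0 < #|T|)%N ->
  (#|[set a : {set 'I_n} * {ffun 'I_n -> 'I_l} |
       (\sum_j entry a j * x j == 0)%R]| ^ 2 * (#|T| * l ^ 2) <=
   #|{: {set 'I_n} * {ffun 'I_n -> 'I_l}}| ^ 2)%N.
Proof.
move=> v0 /card_gt0P[j0 j0T]; set A := [set a | _].
have [->|/set0Pn[[E0 b0] a0A]] := eqVneq A set0; first by rewrite cards0.
(* [g] erases [a.1] on [T] and the digit at [j0], so it takes values in a set of size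
   [2^(n - #|T|) * l^(n-1)]; [z] is an arbitrary digit marking the erased place. *)
pose z := b0 j0.
pose g (a : {set 'I_n} * {ffun 'I_n -> 'I_l}) :=
  (a.1 :\: T, [ffun j => if j == j0 then z else a.2 j]).
pose Y := setX (powerset (~: T)) [set b in pffun_on z (predC1 j0) predT].
have lgt0 : (0 < l)%N by apply: leq_ltn_trans (ltn_ord z).
have cardY : #|Y| = (2 ^ (n - #|T|) * l ^ n.-1)%N.
  rewrite cardsX card_powerset; congr (2 ^ _ * _)%N.
    by rewrite cardsCs setCK card_ord.
  rewrite cardsE (eqP (introT eqP (card_pffun_on z (predC1 j0) predT))).
  by rewrite (@cardC1 _ j0) (@eq_card _ _ predT) ?card_ord.
have gY a : a \in A -> g a \in Y.
  move=> _; rewrite !inE /= subDset setUCr subsetT /=; apply/pffun_onP; split.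
    by apply/supportP=> j; rewrite inE negbK ffunE => ->.
  by [].
have key a a' : a \in A -> a' \in A -> g a' = g a ->
    #|a'.1 :&: T| = #|a.1 :&: T| /\ a'.2 = a.2.
  move=> /[!inE] /eqP sa /eqP sa' [eqD eqb].
  have offE j : j \notin T -> entry a' j = entry a j.
    move=> jT; have nj : j != j0 by apply: contraNneq jT => ->.
    have /setP/(_ j) := eqD; have /ffunP/(_ j) := eqb.
    by rewrite /entry !ffunE !in_setD (negbTE nj) jT /= => -> ->.
  have : \sum_(j in T) entry a' j = \sum_(j in T) entry a j.
    apply: (mulIf v0); rewrite !big_distrl /=.
    have sumT (c : {set 'I_n} * {ffun 'I_n -> 'I_l}) :
        \sum_(j in T) entry c j * v = \sum_(j in T) entry c j * x j.
      by apply: eq_bigr => j /[!inE] /eqP ->.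
    move: sa sa'; rewrite !sumT !(bigID (mem T) predT) /=.
    rewrite [X in _ -> _ + X = 0 -> _](eq_bigr (fun j => entry a j * x j)).
      by move=> s0 s1; apply: addIr (etrans s1 (esym s0)).
    by move=> j jT; rewrite offE.
  have sumE (c : {set 'I_n} * {ffun 'I_n -> 'I_l}) : \sum_(j in T) entry c j =
      (c.2 j0 + \sum_(j in T | j != j0) c.2 j + l * #|c.1 :&: T|)%N%:Z
      - (l * #|T|)%N%:Z.
    have /= <- := bigD1 j0 j0T (F := fun j => nat_of_ord (c.2 j)) (op := addn).
    rewrite (mulnC l #|T|) -sum_nat_const -sum1_card big_distrr /=.
    rewrite (big_mkcond (mem (c.1 :&: T))) [X in _ = (_ + X)%N%:Z - _](_ : _ =
       \sum_(j in T) l * (j \in c.1))%N.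
      rewrite -big_split /= !(big_morph Posz PoszD (erefl 0%Z)) -sumrB.
      by apply: eq_bigr.
    rewrite [RHS]big_mkcond /=; apply: eq_bigr => j _.
    by rewrite !inE; case: (j \in c.1); case: (x j == v); rewrite ?muln0 ?muln1.
  have eqb' j : j != j0 -> a'.2 j = a.2 j.
    by move=> /negbTE ne; have /ffunP/(_ j) := eqb; rewrite !ffunE ne.
  rewrite !sumE => /addIr [].
  rewrite (eq_bigr (fun j => nat_of_ord (a.2 j))); last first.
    by move=> j /andP[_ ?]; rewrite eqb'.
  set s := bigop _ _ _ => eqs.
  have /eq_digits : (a'.2 j0 + l * #|a'.1 :&: T| = a.2 j0 + l * #|a.1 :&: T|)%N.
    by apply: (@addIn s); rewrite !(addnAC _ _ s).
  move=> /(_ (ltn_ord _) (ltn_ord _)) [/ord_inj eq0 ->]; split=> //.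
  by apply/ffunP => j; have [->|/eqb'] := eqVneq j j0.
(* Within a fibre of [g] all digits are constant, so a row is determined by [a.1 :&: T], whose size
   is constant too. *)
have fib a : a \in A ->
    (#|[set a' in A | g a' == g a]| <= 'C(#|T|, #|a.1 :&: T|))%N.
  move=> aA; rewrite -cards_draws -(@card_in_imset _ _ (fun a' => a'.1 :&: T)).
    apply/subset_leq_card/subsetP => _ /imsetP[a' fa' ->].
    move: fa'; rewrite (in_set (fun _ => _ && _)) => /andP[a'A /eqP ga'].
    by have [cT _] := key _ _ aA a'A ga'; rewrite in_set subsetIr cT eqxx.
  move=> a1 a2; rewrite !(in_set (fun _ => _ && _)).
  move=> /andP[a1A /eqP g1] /andP[a2A /eqP g2] eqI.
  have [_ e12] := key _ _ a1A a2A (etrans g2 (esym g1)).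
  have := etrans g2 (esym g1) => -[eqD _].
  apply: injective_projections; last by [].
  by rewrite -(setID a1.1 T) -(setID a2.1 T) eqI eqD.
(* The size of [a.1 :&: T] may vary between fibres; the largest binomial coefficient serves for
   all. *)
pose aM := [arg max_(a > (E0, b0) in A) 'C(#|T|, #|a.1 :&: T|)].
have /(leq_card_fibers gY) : forall a, a \in A ->
    (#|[set a' in A | g a' == g a]| <= 'C(#|T|, #|aM.1 :&: T|))%N.
  move=> a aA; apply: leq_trans (fib a aA) _.
  by rewrite /aM; case: arg_maxnP => // i _; apply.
have kn : (#|T| <= n)%N by rewrite -[leqRHS]card_ord max_card.
have := bin_sqr_mul #|T| #|aM.1 :&: T|; move: 'C(_, _) => c cT.
rewrite cardY => leA.
rewrite card_prod card_ffun !card_ord -cardsT -powersetT card_powerset cardsT.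
rewrite card_ord.
have -> : (2 ^ n = 2 ^ (n - #|T|) * 2 ^ #|T|)%N by rewrite -expnD subnK.
have -> : (l ^ n = l * l ^ n.-1)%N
  by rewrite -expnS prednK // (leq_trans _ (ltn_ord j0)).
move: leA cT; have -> : (4 = 2 ^ 2)%N by []. rewrite -expnM.
set p := (2 ^ (n - _))%N; set t := (2 ^ #|T|)%N; set L := (l ^ _)%N.
rewrite (mulnC 2) expnM -/t => leA cT.
apply: (@leq_trans ((c * (p * L)) ^ 2 * (#|T| * l ^ 2))%N).
  by rewrite leq_mul2r leq_exp2r // leA orbT.
have -> : ((c * (p * L)) ^ 2 * (#|T| * l ^ 2) =
           c ^ 2 * #|T| * (p * (l * L)) ^ 2)%N by ring.
have -> : ((p * t * (l * L)) ^ 2 = t ^ 2 * (p * (l * L)) ^ 2)%N by ring.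
by rewrite leq_mul2r cT orbT.
Qed.

(** * Existence of a matrix by the first moment method *)

Lemma expR_ge1Dx_exp (R : realType) (c : R) (n : nat) :
  0 <= c -> (0 < n)%N -> (1 + c / n%:R) ^+ n <= expR c.
Proof.
move=> c0 n0; have n0' : 0 < n%:R :> R by rewrite ltr0n.
rewrite -[in leRHS](divfK (lt0r_neq0 n0') c) expRM_natr.
by rewrite lerXn2r ?nnegrE ?expR_ge0 ?expR_ge1Dx // addr_ge0 // divr_ge0 // ltW.
Qed.

Lemma exists_few_hits (R : realType) (Row X : finType) (P : pred X)
    (Z : X -> {set Row}) (p : X -> R) (r m : nat) :
    (0 < r)%N -> (0 < #|Row|)%N ->
    (forall x, P x -> 0 < p x /\ #|Z x|%:R <= p x * #|Row|%:R) ->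
    \sum_(x | P x) (expR 1 * r%:R * p x) ^+ m < 1 ->
  exists M : {ffun 'I_(r * m) -> Row},
    forall x, P x -> (#|[set i | M i \in Z x]| < m)%N.
Proof.
move=> r0 row0 hp small.
have rgt0 : 0 < r%:R :> R by rewrite ltr0n.
(* With this [z], the mean of [z ^+ hit] over one row is at most [1 + 1/r], so the product over
   [r * m] rows has mean at most [e^m], while [1/z <= r p] yields the factor [(r p)^m]. *)
pose z x := 1 + (r%:R * p x)^-1.
pose S x := #|[set M : {ffun 'I_(r * m) -> Row} |
               (m <= #|[set i | M i \in Z x]|)%N]|.
pose T : R := #|Row|%:R ^+ (r * m).
have T0 : 0 < T by rewrite exprn_gt0 // ltr0n.
(* Markov's inequality for [z ^+ #hits], whose mean factors over the rows. *)
have bound x : P x -> (S x)%:R <= (expR 1 * r%:R * p x) ^+ m * T.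
  move=> /hp[p0 leZ]; have rp0 : 0 < r%:R * p x by rewrite mulr_gt0.
  have z1 : 1 <= z x by rewrite lerDl invr_ge0 ltW.
  have z0 : 0 < z x := lt_le_trans ltr01 z1.
  have step : (S x)%:R * z x ^+ m <=
      \sum_(M : {ffun 'I_(r * m) -> Row}) \prod_i z x ^+ (M i \in Z x).
    rewrite /S -sum1_card natr_sum big_distrl /= big_mkcond /=.
    apply: ler_sum => M _; rewrite prodrXr !inE -sum1dep_card big_mkcond /=.
    case: ifP => [le_m|_]; last by rewrite exprn_ge0 // ltW.
    by rewrite mul1r ler_weXn2l.
  have mean : \sum_(M : {ffun 'I_(r * m) -> Row}) \prod_i z x ^+ (M i \in Z x)
      <= T * expR 1 ^+ m.
    rewrite -(bigA_distr_bigA (fun (i : 'I_(r * m)) a => z x ^+ (a \in Z x))).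
    rewrite prodr_const card_ord.
    have -> : \sum_a z x ^+ (a \in Z x) =
        #|Row|%:R + #|Z x|%:R * (r%:R * p x)^-1.
      rewrite -(sum1_card (mem (Z x))) -(sum1_card (mem Row)).
      rewrite !natr_sum big_distrl /=.
      rewrite [X in _ = _ + X]big_mkcond -big_split /=; apply: eq_bigr => a _.
      by case: (a \in Z x); rewrite ?expr1 ?expr0 ?addr0 ?mul1r.
    apply: (@le_trans _ _ ((#|Row|%:R * (1 + 1 / r%:R)) ^+ (r * m))).
      rewrite lerXn2r ?nnegrE.
      - by [].
      - by rewrite addr_ge0 // mulr_ge0 // invr_ge0 ltW.
      - by rewrite mulr_ge0 // addr_ge0 // divr_ge0.
      rewrite mulrDr mulr1 lerD2l ler_pdivrMr //.
      suff -> : #|Row|%:R * (1 / r%:R) * (r%:R * p x) = p x * #|Row|%:R by [].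
      by field; rewrite gt_eqF.
    rewrite exprMn ler_pM2l // exprM lerXn2r ?nnegrE ?expR_ge0 //.
      by rewrite exprn_ge0 // addr_ge0 // divr_ge0.
    exact: expR_ge1Dx_exp.
  have zm : 0 < z x ^+ m by rewrite exprn_gt0.
  rewrite -(ler_pM2r zm); apply: le_trans (le_trans step mean) _.
  rewrite mulrAC -exprMn mulrC ler_pM2r //.
  have -> : expR 1 * r%:R * p x * z x = expR 1 * (r%:R * p x) + expR 1.
    by rewrite /z; field; rewrite !gt_eqF.
  have e0 : 0 < expR 1 :> R := expR_gt0 1.
  have erp0 : 0 <= expR 1 * (r%:R * p x) by rewrite mulr_ge0 // ltW.
  by rewrite lerXn2r ?nnegrE ?lerDr // ?addr_ge0 // ltW.
have [/existsP[M /forallP hM]|/existsPn none] :=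
  boolP [exists M : {ffun 'I_(r * m) -> Row},
   [forall x, P x ==> (#|[set i | M i \in Z x]| < m)%N]].
  by exists M => x; apply/implyP.
(* If no [M] is good, each one is counted in some [S x]; but the bounds on the [S x] sum to less
   than [T]. *)
have : T <= \sum_(x | P x) (S x)%:R.
  rewrite -natr_sum /T -natrX -(card_ord (r * m)) -card_ffun ler_nat.
  rewrite -sum1_card /S; under [leqRHS]eq_bigr do rewrite -sum1_card big_mkcond.
  rewrite exchange_big; apply: leq_sum => M _ /=.
  have := none M; rewrite negb_forall => /existsP[x].
  rewrite negb_imply -leqNgt => /andP[Px hx].
  by rewrite (bigD1 x) //= inE hx.
move/le_trans/(_ (ler_sum _ bound)).
by rewrite -big_distrl /= ler_pMl // leNgt small.
Qed.

(** * Popular values and support sizes *)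

Lemma popular_value (I J : finType) (x : I -> J) (j0 : J) :
    (0 < #|[set i | x i != j0]|)%N ->
  exists j, [/\ j != j0, (0 < #|[set i | x i == j]|)%N &
    (#|[set i | x i != j0]| <= #|[set i | x i == j]| * #|J|)%N].
Proof.
move=> A0; have [i1] := card_gt0P A0; rewrite inE => i1A.
pose j := [arg max_(j > x i1 | j != j0) #|[set i | x i == j]|].
have [jj0 jmax] : j != j0 /\
    forall j', j' != j0 -> (#|[set i | x i == j']| <= #|[set i | x i == j]|)%N.
  by rewrite /j; case: arg_maxnP.
have leA : (#|[set i | x i != j0]| <= #|[set i | x i == j]| * #|J|)%N.
  rewrite -sum1_card (partition_big x [pred j' | j' != j0]) ; last first.
    by move=> i; rewrite inE.
  rewrite mulnC -sum_nat_const big_mkcond; apply: leq_sum => j' _.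
  case: ifP => //= j'0.
  apply: leq_trans (jmax _ j'0); rewrite -sum1_card.
  apply: eq_leq; apply: eq_bigl => i; rewrite !inE.
  by case: (eqVneq (x i) j') => [->|]; rewrite ?andbF ?j'0.
exists j; split=> //; have := leq_trans A0 leA.
by rewrite muln_gt0 => /andP[].
Qed.

(** Expanding the product over coordinates lists all [x], each coordinate other than [j0] giving one
    factor [y]. *)
Lemma sum_expr_support (R : realType) (I J : finType) (j0 : J) (y : R) :
  \sum_(x : {ffun I -> J}) y ^+ #|[set i | x i != j0]|
    = (1 + y *+ #|J|.-1) ^+ #|I|.
Proof.
have -> : 1 + y *+ #|J|.-1 = \sum_(j : J) y ^+ (j != j0).
  rewrite (bigD1 j0) //= eqxx expr0; congr (_ + _).
  rewrite (eq_bigr (fun=> y)) => [|j ->]; last by rewrite expr1.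
  by rewrite sumr_const cardC1.
rewrite -[RHS]prodr_const bigA_distr_bigA; apply: eq_bigr => x _.
rewrite prodrXr -sum1_card big_mkcond; congr (_ ^+ _); apply: eq_bigr => i _.
by rewrite inE; case: (_ != _).
Qed.

(** The code [x j] stands for the integer [x j - q], so [i0] codes zero. The last assumption is
    [w >= 1 / (e sqrt s)], squared, and [w / (e r)] is the probability [p] for which the union
    bound's factor [e r p] becomes [w]. *)
Lemma popular_hit (R : realType) (q n K r : nat)
    (x : {ffun 'I_n -> 'I_q.*2.+1}) (w : R) (i0 := inord q : 'I_q.*2.+1)
    (s := #|[set j | x j != i0]|) :
    (0 < r)%N -> expR 2 * q.*2.+1%:R <= K%:R :> R -> (0 < s)%N ->
    0 < w -> expR (- 2) <= w ^+ 2 * s%:R :> R ->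
  (#|[set a : {set 'I_n} * {ffun 'I_n -> 'I_(K * r)} |
     (\sum_j entry a j * ((x j)%:Z - q%:Z) == 0)%R]|%:R : R) <=
  w / (expR 1 * r%:R) * #|{: {set 'I_n} * {ffun 'I_n -> 'I_(K * r)}}|%:R.
Proof.
move=> r0 hK s0 w0 hw; have [i [ii0]] := popular_value s0.
rewrite card_ord -/s; set k := #|_| => k0 hk.
pose v : int := i%:Z - q%:Z.
have v0 : v != 0.
  apply: contraNneq ii0 => /eqP; rewrite subr_eq0 => /eqP[iq].
  by apply/eqP/val_inj; rewrite /= inordK //; lia.
have eT : [set j | (x j)%:Z - q%:Z == v] = [set j | x j == i].
  by apply/setP => j; rewrite !inE /v (inj_eq (addIr _)).
have := @card_orthogonal_sqr n (K * r) (fun j => (x j)%:Z - q%:Z) v v0.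
rewrite eT -/k => /(_ k0).
set Z := #|[set a | \sum_j _ == 0]|; set T := #|{: _ * _}|.
rewrite -(ler_nat R) !(natrX, natrM) => hZ.
have er0 : 0 < expR 1 * r%:R :> R by rewrite mulr_gt0 ?expR_gt0 ?ltr0n.
have wer0 : 0 <= w / (expR 1 * r%:R) by rewrite divr_ge0 // ltW.
rewrite -(@ler_pXn2r _ 2) ?nnegrE // ?(mulr_ge0 wer0) //.
set E : R := expR 1 in er0 wer0 *; have E0 : 0 < E by apply: expR_gt0.
have e2 : expR 2 = E ^+ 2 by rewrite -expRM_natr mul1r.
move: hK hw; rewrite expRN e2 => hK hw.
have w2 : 0 <= w ^+ 2 by rewrite sqr_ge0.
have r2 : 0 < r%:R :> R by rewrite ltr0n.
(* With [D = 2q+1], the facts [K >= e^2 D], [k D >= s] and [w^2 s >= e^-2] bound the right side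
   below by [e^2 D]. *)
have main : E ^+ 2 <= w ^+ 2 * k%:R * K%:R ^+ 2.
  have hk' : s%:R <= k%:R * q.*2.+1%:R :> R by rewrite -natrM ler_nat.
  have D1 : 1 <= q.*2.+1%:R :> R by rewrite ler1n.
  set D : R := _.+1%:R in hk' D1 hK; have D0 : 0 <= D := le_trans ler01 D1.
  apply: (@le_trans _ _ (w ^+ 2 * k%:R * (E ^+ 2 * D) ^+ 2)); last first.
    apply: ler_wpM2l; first by rewrite mulr_ge0.
    by apply: lerXn2r; rewrite ?nnegrE ?mulr_ge0 ?(ltW E0).
  have -> : w ^+ 2 * k%:R * (E ^+ 2 * D) ^+ 2 =
            w ^+ 2 * (k%:R * D) * (E ^+ 4 * D) by ring.
  apply: (@le_trans _ _ ((E ^+ 2)^-1 * (E ^+ 4 * D))).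
    have -> : (E ^+ 2)^-1 * (E ^+ 4 * D) = E ^+ 2 * D by field; rewrite gt_eqF.
    by rewrite ler_peMr // sqr_ge0.
  rewrite ler_wpM2r ?mulr_ge0 ?exprn_ge0 ?(ltW E0) //.
  by apply: le_trans hw _; rewrite ler_wpM2l.
rewrite !exprMn exprVn; apply: le_trans (ler_wpM2l _ hZ); last first.
  by rewrite divr_ge0 // sqr_ge0.
rewrite -[leLHS]mulr1.
have -> : w ^+ 2 / (E * r%:R) ^+ 2 * (Z%:R ^+ 2 * (k%:R * (K%:R * r%:R) ^+ 2)) =
   Z%:R ^+ 2 * (w ^+ 2 * k%:R * K%:R ^+ 2 / E ^+ 2).
  by field; rewrite !gt_eqF.
by rewrite ler_wpM2l ?sqr_ge0 // ler_pdivlMr ?exprn_gt0 // mul1r.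
Qed.

(** * Estimates for the union bound *)

Lemma sqrt_exp_growth (R : realType) (C u : R) :
    96 <= u -> C <= u ->
  expR (u / 2) * u + C <= expR u / u.
Proof.
move=> u96 uC; set h := expR (u / 2).
have u0 : 0 < u by apply: lt_le_trans u96.
have h1 : 1 <= h by rewrite -expR0 ler_expR divr_ge0 // ltW.
have -> : expR u = h * h by rewrite -expRD; congr expR; field.
(* The cubic term of the exponential series at [u / 2]. It gives [e^u / u >= h u^2 / 48 >= 2 h u]
   for [u >= 96], and [h u >= u >= C]. *)
have h3 : u ^+ 3 / 48 <= h.
  have u2 : 0 <= u / 2 by rewrite divr_ge0 // ltW.
  apply: le_trans (expR_ge1Dxn 2 u2); rewrite (_ : 3`! = 6)%N //.
  by rewrite (_ : (u / 2) ^+ 3 / 6 = u ^+ 3 / 48) ?lerDr //; field.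
apply: (@le_trans _ _ (h * (u ^+ 2 / 48))); last first.
  rewrite -mulrA ler_pM2l ?(lt_le_trans ltr01) //.
  rewrite ler_pdivlMr // (le_trans _ h3) // le_eqVlt; apply/orP; left.
  by apply/eqP; ring.
have : u + u <= u ^+ 2 / 48 by rewrite expr2; nra.
by nra.
Qed.

(** Both kinds of [x] contribute at most [1/e < 1/2]. If [s <= sqrt n], the weight [e^-m] is at most
    [A n^-s], and [n^-s] summed over all [x] is [(1 + 2q/n)^n <= e^(2q)]. The others have weight [B]
    and number at most [(2q+1)^n <= e^(2qn)]. *)
Lemma sum_weights_lt1 (R : realType) (q n m : nat) (i0 : 'I_q.*2.+1)
    (supp := fun x : {ffun 'I_n -> 'I_q.*2.+1} => #|[set j | x j != i0]|)
    (u := ln (n%:R : R)) :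
    (0 < n)%N -> (0 < m)%N -> 0 < u -> (8 * q%:R) * n%:R <= m%:R * u ->
    expR (u / 2) * u + (2 * q%:R + 1) <= m%:R ->
  \sum_(x | (0 < supp x)%N)
    (if (supp x ^ 2 <= n)%N then expR (- 1) else expR (- 1 - u / 4)) ^+ m
  < 1 :> R.
Proof.
move=> n0 m0 u0 hmu hm; set h := expR (u / 2) in hm.
have n0' : 0 < n%:R :> R by rewrite ltr0n.
have eu : expR u = n%:R by rewrite lnK ?posrE.
have hh : h ^+ 2 = n%:R by rewrite -expRM_natr -eu; congr expR; field.
pose A := expR (- m%:R + h * u); pose B := expR (- m%:R - m%:R * u / 4).
apply: (@le_lt_trans _ _ (\sum_x (A * (n%:R^-1) ^+ supp x + B))).
  rewrite big_mkcond; apply: ler_sum => x _.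
  have As0 : 0 <= A * n%:R^-1 ^+ supp x.
    by rewrite mulr_ge0 ?expR_ge0 ?exprn_ge0 ?invr_ge0.
  case: ifP => _; last by rewrite addr_ge0 ?expR_ge0.
  case: ifP => [le_n|_]; rewrite -expRM_natr; last first.
    by rewrite (_ : (_ * _) = - m%:R - m%:R * u / 4) ?lerDr //; field.
  rewrite mulN1r; apply: (@le_trans _ _ (A * n%:R^-1 ^+ supp x)); last first.
    by rewrite lerDl expR_ge0.
  have sh : (supp x)%:R <= h.
    by rewrite -(@ler_pXn2r _ 2) ?nnegrE ?expR_ge0 // hh -natrX ler_nat.
  rewrite -eu -expRN -expRM_natr -expRD ler_expR.
  by have := ler_wpM2r (ltW u0) sh; lra.
rewrite big_split /= -big_distrr /= sum_expr_support sumr_const.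
rewrite -[B *+ _]mulr_natr card_ffun !card_ord /= natrX.
have e2 : expR (- 1) < 1 / 2 :> R.
  have : 2 < expR 1 :> R by have := @expR_gt1Dx R 1; rewrite oner_neq0; apply.
  by rewrite expRN -[1 / 2]/(1 * 2^-1) mul1r ltf_pV2 // posrE ?expR_gt0.
have leA : A * (1 + n%:R^-1 *+ q.*2) ^+ n <= expR (- 1).
  have q0 : 0 <= 2 * q%:R :> R by rewrite mulr_ge0.
  apply: (@le_trans _ _ (A * expR (2 * q%:R))).
    rewrite ler_wpM2l ?expR_ge0 //; apply: le_trans (expR_ge1Dx_exp q0 n0).
    by rewrite -[_ *+ q.*2]mulr_natl -mul2n natrM.
  by rewrite -expRD ler_expR; lra.
have leB : B * q.*2.+1%:R ^+ n <= expR (- 1).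
  apply: (@le_trans _ _ (B * expR (2 * q%:R * n%:R))).
    rewrite ler_wpM2l ?expR_ge0 // expRM_natr lerXn2r ?nnegrE ?expR_ge0 //.
    by apply: le_trans (expR_ge1Dx _); rewrite -addn1 natrD addrC -mul2n natrM.
  (* Since [2 q n <= m u / 4], at most [e^-m] is left. *)
  rewrite -expRD ler_expR.
  have m1 : 1 <= m%:R :> R by rewrite ler1n.
  by lra.
by apply: le_lt_trans (lerD leA leB) _; lra.
Qed.

(** * Choice of constants and conclusion *)

Lemma inord_shift (q : nat) (z : int) : - q%:Z + 1 <= z <= q%:Z - 1 ->
  (inord (absz (z + q%:Z)) : 'I_q.*2.+1)%:Z - q%:Z = z.
Proof. by move=> hz; rewrite inordK; lia. Qed.

Theorem theorem4 (R : realType) (q : nat) (hq : (2 <= q)%N) :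
  exists (c1 c2 : R) (N : nat),
    [/\ 0 < c1, 0 < c2 &
      forall n r m : nat, (N <= n)%N -> (0 < r)%N -> (0 < m)%N ->
        c1 * n%:R / ln (n%:R : R) <= m%:R ->
        exists M : 'M[int]_(r * m, n),
          RMDS_matrix q M /\
          forall (i : 'I_(r * m)) (j : 'I_n),
            - Num.ceil (c2 * r%:R) <= M i j <= Num.ceil (c2 * r%:R)].
Proof.
(* [K] is as [popular_hit] requires, [C] is the constant in [sum_weights_lt1], and [N] forces
   [ln n >= 96 + C], enough for [sqrt_exp_growth]. *)
pose K := Num.bound (expR 2 * q.*2.+1%:R : R).
pose C : R := 2 * q%:R + 1.
pose N := Num.bound (expR (96 + C)).
have hK : expR 2 * q.*2.+1%:R <= K%:R :> R.
  by apply/ltW/archi_boundP; rewrite mulr_ge0 ?expR_ge0.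
have K0 : 0 < K%:R :> R by apply: lt_le_trans hK; rewrite mulr_gt0 ?expR_gt0.
have q0 : 0 < q%:R :> R by rewrite ltr0n (ltn_trans _ hq).
exists (8 * q%:R), K%:R, N; split=> //; first by rewrite mulr_gt0.
move=> n r m hN r0 m0; set u := ln _ => hm.
have Kr0 : (0 < K * r)%N by rewrite muln_gt0 r0 andbT -(ltr0n R).
have C0 : 0 < C by rewrite /C addr_gt0 // mulr_gt0.
have leN : expR (96 + C) <= n%:R.
  apply: (@le_trans _ _ N%:R); last by rewrite ler_nat.
  by apply/ltW/archi_boundP; rewrite expR_ge0.
have n0' : 0 < n%:R :> R := lt_le_trans (expR_gt0 _) leN.
have eu : expR u = n%:R by rewrite lnK ?posrE.
have leu : 96 + C <= u by rewrite -ler_expR eu.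
have u0 : 0 < u by lra.
have hmu : 8 * q%:R * n%:R <= m%:R * u by rewrite -ler_pdivrMr.
have hm2 : expR (u / 2) * u + C <= m%:R.
  apply: le_trans (sqrt_exp_growth _ _) _; [lra|lra|].
  apply: le_trans hm; rewrite eu ler_pM2r ?invr_gt0 //.
  apply: ler_peMl; first exact: ltW.
  by rewrite -natrM ler1n muln_gt0 (ltn_trans _ hq).
have n0 : (0 < n)%N by rewrite -(ltr0n R).
pose i0 : 'I_q.*2.+1 := inord q.
pose supp (x : {ffun 'I_n -> 'I_q.*2.+1}) := #|[set j | x j != i0]|.
(* For nonzero [x] this is at least [1 / (e sqrt s)]: [s >= 1] in the first case,
   [s > sqrt n = e^(u/2)] in the second. *)
pose w x : R := if (supp x ^ 2 <= n)%N then expR (- 1) else expR (- 1 - u / 4).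
pose Row := ({set 'I_n} * {ffun 'I_n -> 'I_(K * r)})%type.
pose Z (x : {ffun 'I_n -> 'I_q.*2.+1}) : {set Row} :=
  [set a | \sum_j entry a j * ((x j)%:Z - q%:Z) == 0].
have er0 : 0 < expR 1 * r%:R :> R by rewrite mulr_gt0 ?expR_gt0 ?ltr0n.
have Row0 : (0 < #|{: Row}|)%N.
  by apply/card_gt0P; exists (set0, [ffun=> Ordinal Kr0]).
have hits x : (0 < supp x)%N -> 0 < w x / (expR 1 * r%:R) /\
    #|Z x|%:R <= w x / (expR 1 * r%:R) * #|{: Row}|%:R.
  move=> s0; have w0 : 0 < w x by rewrite /w; case: ifP; rewrite expR_gt0.
  split; first by rewrite divr_gt0.
  apply: popular_hit => //; rewrite /w -/i0 -/(supp x); case: ifPn => [_|].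
    by rewrite -expRM_natr mulN1r ler_peMr ?expR_ge0 ?ler1n.
  rewrite -ltnNge => ltn; set s : R := (supp x)%:R.
  have -> : expR (- 1 - u / 4) ^+ 2 = expR (- 2) * expR (- (u / 2)) :> R.
    by rewrite -expRM_natr -expRD; congr expR; field.
  rewrite -mulrA ler_peMr ?expR_ge0 // expRN mulrC.
  rewrite ler_pdivlMr ?expR_gt0 // mul1r.
  rewrite -(@ler_pXn2r _ 2) ?nnegrE ?expR_ge0 // -expRM_natr.
  rewrite divfK ?pnatr_eq0 //.
  by rewrite eu -natrX ler_nat ltnW.
have small : \sum_(x | (0 < supp x)%N)
    (expR 1 * r%:R * (w x / (expR 1 * r%:R))) ^+ m < 1.
  under eq_bigr do rewrite mulrC divfK ?gt_eqF //.
  exact: sum_weights_lt1.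
have [M hM] := exists_few_hits r0 Row0 hits small.
exists (\matrix_(i, j) entry (M i) j); split; last first.
  move=> i j; rewrite mxE -natrM.
  have -> : Num.ceil ((K * r)%:R : R) = (K * r)%:Z.
    by apply/eqP; rewrite ceil_eq rmorphB /= -pmulrn; lra.
  exact: entry_bounds.
move=> f f_incr y hy My0; apply/eqP/negPn/negP => y0.
have f_inj : injective f.
  move=> i j fij; apply/val_inj; case: (ltngtP i j) => // /f_incr.
    by rewrite fij ltnn.
  by rewrite fij ltnn.
pose x : {ffun 'I_n -> 'I_q.*2.+1} :=
  [ffun j => inord (absz (y j ord0 + q%:Z))].
have xE j : (x j)%:Z - q%:Z = y j ord0.
  by rewrite ffunE inord_shift.
have sx : (0 < supp x)%N.
  rewrite card_gt0; apply: contraNneq y0 => /setP x0.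
  apply/eqP/matrixP => j k; rewrite mxE ord1 -xE.
  have := x0 j; rewrite !inE => /negbFE/eqP ->.
  by rewrite /i0 inordK ?subrr // ltnS -addnn leq_addr.
(* The [m] rows chosen by [f] are distinct and all orthogonal to [y], one more than [hM] allows. *)
have := hM x sx; rewrite ltnNge => /negP; apply.
rewrite -[leqLHS]card_ord -(card_codom f_inj).
apply/subset_leq_card/subsetP => _ /codomP[i ->].
rewrite !inE; apply/eqP; have /matrixP/(_ i ord0) := My0; rewrite !mxE => s0.
by rewrite -[RHS]s0; apply: eq_bigr => j _; rewrite !mxE xE.
Qed.
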